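(* There exists an uncountable group $Q$ such that $Q$ is a homomorphic image of the Hawaiian earring group $\mathbb{H}$, $Q$ embeds (as a subgroup) in an inverse limit of free groups, and $Q$ is neither isomorphic to the Hawaiian earring group $\mathbb{H}$ nor a free group.
   Context: The Hawaiian earring $\mathbf{E}$ is the subspace of the plane that is the union over $n\geq 1$ of the circles of radius $\frac1n$ centered at $(0,\frac1n)$ (equivalently, up to homeomorphism, the one-point compactification of a sequence of disjoint open arcs). The Hawaiian earring group is $\mathbb{H}=\pi_1(\mathbf{E},(0,0))$; ''a Hawaiian earring group'' means a group isomorphic to $\mathbb{H}$. An inverse system of groups indexed by a partially ordered set $J$ is a family of groups $F_\alpha$ ($\alpha\in J$) together with connecting homomorphisms $\phi_{\alpha,\beta}:F_\alpha\to F_\beta$ for $\alpha\geq\beta$, such that $\phi_{\beta,\gamma}\circ\phi_{\alpha,\beta}=\phi_{\alpha,\gamma}$ whenever $\alpha\geq\beta\geq\gamma$. Its inverse limit is the subgroup of the direct product $\prod_{\alpha\in J}F_\alpha$ consisting of the functions $f$ with $f(\alpha)\in F_\alpha$ and $f(\beta)=\phi_{\alpha,\beta}(f(\alpha))$ for all $\beta\leq\alpha$. An inverse limit of free groups is the inverse limit of such a system in which every $F_\alpha$ is a free group. *)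

(* Defs.v *)
From HB Require Import structures.
From mathcomp Require Import all_boot all_order all_algebra.
From mathcomp Require Import generic_quotient ring lra.
From mathcomp Require Import all_classical all_reals topology normedtype homotopy.

Set Implicit Arguments.
Unset Strict Implicit.
Unset Printing Implicit Defensive.

Import Order.TTheory GRing.Theory Num.Theory.
Import numFieldNormedType.Exports.

Local Open Scope classical_set_scope.
Local Open Scope ring_scope.

Section Continuity.
Context {X Y Z : topologicalType}.

Lemma comp_continuous (f : X -> Y) (g : Y -> Z) :
  continuous f -> continuous g -> continuous (fun x => g (f x)).
Proof. by move=> cf cg x; apply: continuous_comp; [exact: cf|exact: cg]. Qed.

Lemma pair_continuous (f : X -> Y) (g : X -> Z) :
  continuous f -> continuous g -> continuous (fun x => (f x, g x)).
Proof. by move=> cf cg x; apply: cvg_pair; [exact: cf|exact: cg]. Qed.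

Lemma fst_continuous : continuous (@fst X Y).
Proof. by move=> x; exact: cvg_fst. Qed.

Lemma snd_continuous : continuous (@snd X Y).
Proof. by move=> x; exact: cvg_snd. Qed.

End Continuity.

Section UnitInterval.
Context {R : realType}.

Definition unit_interval : Type := set_type `[0 : R, 1].

HB.instance Definition _ := Choice.on unit_interval.
HB.instance Definition _ := Topological.copy unit_interval (set_type `[0 : R, 1]).

Definition uval (t : unit_interval) : R := \val t.

Lemma uval_itv t : 0 <= uval t <= 1.
Proof. by have := valP t; rewrite inE /= in_itv. Qed.

Lemma clamp_subproof (r : R) : Num.max 0 (Num.min 1 r) \in `[0, 1]%classic.
Proof. by rewrite inE /= in_itv /= le_max lexx /= ge_max ler01 ge_min lexx. Qed.

(* The retraction of the line onto [0, 1]. *)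
Definition clamp (r : R) : unit_interval :=
  exist (fun x => x \in `[0 : R, 1]%classic) _ (clamp_subproof r).

Lemma uval_clamp r : uval (clamp r) = Num.max 0 (Num.min 1 r).
Proof. by []. Qed.

Lemma uval_inj : injective uval.
Proof. exact: val_inj. Qed.

Lemma clamp_uval t : clamp (uval t) = t.
Proof.
apply: uval_inj; rewrite uval_clamp; have /andP[t0 t1] := uval_itv t.
by rewrite min_r // max_r.
Qed.

Lemma uval_clamp_id r : 0 <= r <= 1 -> uval (clamp r) = r.
Proof. by move=> /andP[r0 r1]; rewrite uval_clamp min_r // max_r. Qed.

Lemma uzero_neq_one : clamp 0 != clamp 1.
Proof.
apply/eqP => /(congr1 uval); rewrite !uval_clamp_id ?lexx ?ler01 //.
by move/eqP; rewrite eq_sym oner_eq0.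
Qed.

HB.instance Definition _ :=
  isBiPointed.Build unit_interval uzero_neq_one.

Lemma uval0 : uval zero = 0.
Proof. by rewrite uval_clamp_id // lexx ler01. Qed.

Lemma uval1 : uval one = 1.
Proof. by rewrite uval_clamp_id // lexx ler01. Qed.

Lemma uval_continuous : continuous uval.
Proof. exact: initial_continuous. Qed.

Lemma clamp_continuous : continuous clamp.
Proof.
apply: continuous_comp_initial => r.
rewrite (_ : _ \o _ = fun r => Num.max 0 (Num.min 1 r)) //.
apply: continuous_max; first exact: cvg_cst.
by apply: continuous_min; [exact: cvg_cst|exact: cvg_id].
Qed.

Lemma clamp_comp_continuous (f : R -> R) :
  continuous f -> continuous (fun t => clamp (f (uval t))).
Proof.
move=> cf t; apply: (@continuous_comp _ _ _ uval (clamp \o f)).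
  exact: uval_continuous.
by apply: (@continuous_comp _ _ _ f clamp); [exact: cf|exact: clamp_continuous].
Qed.

Lemma paste_continuous {X T : topologicalType} (h : X -> R) (c : R)
    (f g : X -> T) :
  continuous h -> continuous f -> continuous g ->
  (forall x, h x = c -> f x = g x) ->
  continuous (fun x => if h x <= c then f x else g x).
Proof.
move=> ch cf cg fg.
apply/continuous_subspace_setT.
have -> : [set: X] = h @^-1` [set r | r <= c] `|` h @^-1` [set r | c <= r].
  by apply/seteqP; split=> // x _ /=; have [|/ltW] := leP (h x) c; auto.
apply: withinU_continuous.
- by apply: preimage_closed (@closed_le _ c) => x _; exact: ch.
- by apply: preimage_closed (@closed_ge _ c) => x _; exact: ch.
- apply: (@subspace_eq_continuous _ _ _ f); last exact: continuous_subspaceT.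
  by move=> x; rewrite inE /= => xc; rewrite /from_subspace xc.
- apply: (@subspace_eq_continuous _ _ _ g); last exact: continuous_subspaceT.
  move=> x; rewrite inE /from_subspace /= => cx; case: ifP => // xc.
  by rewrite fg //; apply/eqP; rewrite eq_le xc cx.
Qed.

Lemma addr_continuous {X : topologicalType} (f g : X -> R) :
  continuous f -> continuous g -> continuous (fun x => f x + g x).
Proof. by move=> cf cg x; apply: cvgD; [exact: cf|exact: cg]. Qed.

Lemma subr_continuous {X : topologicalType} (f g : X -> R) :
  continuous f -> continuous g -> continuous (fun x => f x - g x).
Proof. by move=> cf cg x; apply: cvgB; [exact: cf|exact: cg]. Qed.

Lemma mulr_continuous {X : topologicalType} (f g : X -> R) :
  continuous f -> continuous g -> continuous (fun x => f x * g x).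
Proof. by move=> cf cg x; apply: cvgM; [exact: cf|exact: cg]. Qed.

End UnitInterval.
Arguments unit_interval : clear implicits.

Section Homotopy.
Context {R : realType} {T : topologicalType}.
Local Notation I := (unit_interval R).
Local Notation ipath x y := {path I from x to y in T}.

(* Homotopy relative to the endpoints. *)
Definition path_homotopic {x y : T} (p q : ipath x y) : Prop :=
  exists H : I * I -> T,
    [/\ continuous H, forall s, H (s, zero) = p s, forall s, H (s, one) = q s
      & forall t, H (zero, t) = x /\ H (one, t) = y].

Lemma reparam_homotopic {x y : T} (f : I -> T) (phi psi : I -> I)
    (p q : ipath x y) :
  continuous f -> continuous phi -> continuous psi ->
  phi zero = psi zero -> phi one = psi one ->
  p =1 f \o phi -> q =1 f \o psi -> path_homotopic p q.
Proof.
move=> cf cphi cpsi e0 e1 ep eq.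
pose g (st : I * I) : R :=
  uval (phi st.1) + uval st.2 * (uval (psi st.1) - uval (phi st.1)).
have cu (h : I -> I) :
    continuous h -> continuous (fun st : I * I => uval (h st.1)).
  move=> ch; apply: (comp_continuous (comp_continuous fst_continuous ch)).
  exact: uval_continuous.
have cg : continuous g.
  apply: addr_continuous; first exact: cu.
  apply: mulr_continuous; last by apply: subr_continuous; exact: cu.
  exact: comp_continuous snd_continuous uval_continuous.
exists (fun st => f (clamp (g st))); split.
- exact: comp_continuous (comp_continuous cg clamp_continuous) cf.
- by move=> s; rewrite /g /= uval0 mul0r addr0 clamp_uval ep.
- by move=> s; rewrite /g /= uval1 mul1r addrC subrK clamp_uval eq.
- move=> t; rewrite /g /= -e0 -e1 !subrr !mulr0 !addr0 !clamp_uval.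
  by split; [rewrite -(@path_zero _ _ _ _ p) ep|rewrite -(@path_one _ _ _ _ p) ep].
Qed.

Lemma path_homotopic_refl {x y : T} (p : ipath x y) : path_homotopic p p.
Proof.
by apply: (@reparam_homotopic _ _ p id id) => //;
  [exact: cts_fun|move=> ?; exact: cvg_id..].
Qed.

Definition urev (t : I) : I := clamp (1 - uval t).

Lemma urev_continuous : continuous urev.
Proof.
apply: (@clamp_comp_continuous _ (fun r => 1 - r)) => r.
by apply: cvgB; [exact: cvg_cst|exact: cvg_id].
Qed.

Lemma urev0 : urev zero = one.
Proof. by rewrite /urev uval0 subr0 -uval1 clamp_uval. Qed.

Lemma urev1 : urev one = zero.
Proof. by rewrite /urev uval1 subrr -uval0 clamp_uval. Qed.

Lemma path_homotopic_sym {x y : T} (p q : ipath x y) :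
  path_homotopic p q -> path_homotopic q p.
Proof.
move=> [H [cH H0 H1 Hxy]]; exists (fun st => H (st.1, urev st.2)); split.
- apply: comp_continuous cH; apply: pair_continuous fst_continuous _.
  exact: comp_continuous snd_continuous urev_continuous.
- by move=> s /=; rewrite urev0 H1.
- by move=> s /=; rewrite urev1 H0.
- by move=> t /=; exact: Hxy.
Qed.

Definition first_half (t : I) : I := clamp (2 * uval t).
Definition second_half (t : I) : I := clamp (2 * uval t - 1).

Lemma first_half_continuous : continuous first_half.
Proof.
apply: (@clamp_comp_continuous _ (fun r => 2 * r)) => r.
by apply: cvgM; [exact: cvg_cst|exact: cvg_id].
Qed.

Lemma second_half_continuous : continuous second_half.
Proof.
apply: (@clamp_comp_continuous _ (fun r => 2 * r - 1)) => r.
apply: cvgB; last exact: cvg_cst.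
by apply: cvgM; [exact: cvg_cst|exact: cvg_id].
Qed.

Lemma first_half_mid (t : I) : uval t = 2^-1 -> first_half t = one.
Proof.
by move=> e; rewrite /first_half e mulfV ?pnatr_eq0 // -uval1 clamp_uval.
Qed.

Lemma second_half_mid (t : I) : uval t = 2^-1 -> second_half t = zero.
Proof.
by move=> e; rewrite /second_half e mulfV ?pnatr_eq0 // subrr -uval0 clamp_uval.
Qed.

Lemma first_half0 : first_half zero = zero.
Proof. by rewrite /first_half uval0 mulr0 -uval0 clamp_uval. Qed.

Lemma second_half1 : second_half one = one.
Proof.
by rewrite /second_half uval1 mulr1 (_ : 2 - 1 = 1) -?uval1 ?clamp_uval ?uval1 //;
  ring.
Qed.

Lemma uval0_le : uval (zero : I) <= 2^-1.
Proof. by rewrite uval0; lra. Qed.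

Lemma uval1_le : (uval (one : I) <= 2^-1) = false.
Proof. by rewrite uval1; apply/negP; lra. Qed.

Lemma path_homotopic_trans {x y : T} (p q r : ipath x y) :
  path_homotopic p q -> path_homotopic q r -> path_homotopic p r.
Proof.
move=> [H [cH H0 H1 Hxy]] [K [cK K0 K1 Kxy]].
exists (fun st => if uval st.2 <= 2^-1 then H (st.1, first_half st.2)
                  else K (st.1, second_half st.2)); split.
- apply: paste_continuous.
  + exact: comp_continuous snd_continuous uval_continuous.
  + apply: comp_continuous cH; apply: pair_continuous fst_continuous _.
    exact: comp_continuous snd_continuous first_half_continuous.
  + apply: comp_continuous cK; apply: pair_continuous fst_continuous _.
    exact: comp_continuous snd_continuous second_half_continuous.
  + by move=> [s t] /= e; rewrite first_half_mid ?second_half_mid // H1 K0.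
- by move=> s /=; rewrite uval0_le first_half0 H0.
- by move=> s /=; rewrite uval1_le second_half1 K1.
- by move=> t /=; case: ifP => _; [exact: Hxy|exact: Kxy].
Qed.

Definition path_concat_fun {x y z : T} (p : ipath x y) (q : ipath y z) (t : I) : T :=
  if uval t <= 2^-1 then p (first_half t) else q (second_half t).

Lemma path_concat_continuous {x y z : T} (p : ipath x y) (q : ipath y z) :
  continuous (path_concat_fun p q).
Proof.
apply: paste_continuous.
- exact: uval_continuous.
- by apply: comp_continuous first_half_continuous _; exact: cts_fun.
- by apply: comp_continuous second_half_continuous _; exact: cts_fun.
- move=> t e; rewrite first_half_mid ?second_half_mid //.
  by rewrite path_one path_zero.
Qed.

Lemma path_concat_zero {x y z : T} (p : ipath x y) (q : ipath y z) :
  path_concat_fun p q zero = x.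
Proof. by rewrite /path_concat_fun uval0_le first_half0 path_zero. Qed.

Lemma path_concat_one {x y z : T} (p : ipath x y) (q : ipath y z) :
  path_concat_fun p q one = z.
Proof. by rewrite /path_concat_fun uval1_le second_half1 path_one. Qed.

Definition path_concat {x y z : T} (p : ipath x y) (q : ipath y z) : ipath x z :=
  mk_path (@path_concat_continuous _ _ _ p q) (path_concat_zero p q)
    (path_concat_one p q).

Lemma path_rev_continuous {x y : T} (p : ipath x y) : continuous (p \o urev).
Proof.
by apply: comp_continuous urev_continuous _; exact: cts_fun.
Qed.

Lemma path_rev_zero {x y : T} (p : ipath x y) : (p \o urev) zero = y.
Proof. by rewrite /= urev0 path_one. Qed.

Lemma path_rev_one {x y : T} (p : ipath x y) : (p \o urev) one = x.
Proof. by rewrite /= urev1 path_zero. Qed.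

Definition path_rev {x y : T} (p : ipath x y) : ipath y x :=
  mk_path (@path_rev_continuous _ _ p) (path_rev_zero p) (path_rev_one p).

Definition path_cst (x : T) : ipath x x := cst x.

Lemma path_concat_homotopic {x y z : T} (p p' : ipath x y) (q q' : ipath y z) :
  path_homotopic p p' -> path_homotopic q q' ->
  path_homotopic (path_concat p q) (path_concat p' q').
Proof.
move=> [H [cH H0 H1 Hxy]] [K [cK K0 K1 Kyz]].
exists (fun st => if uval st.1 <= 2^-1 then H (first_half st.1, st.2)
                  else K (second_half st.1, st.2)); split.
- apply: paste_continuous.
  + exact: comp_continuous fst_continuous uval_continuous.
  + apply: comp_continuous cH; apply: pair_continuous _ snd_continuous.
    exact: comp_continuous fst_continuous first_half_continuous.
  + apply: comp_continuous cK; apply: pair_continuous _ snd_continuous.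
    exact: comp_continuous fst_continuous second_half_continuous.
  + move=> [s t] /= e; rewrite first_half_mid ?second_half_mid //.
    by rewrite (Hxy t).2 (Kyz t).1.
- by move=> s; rewrite /= /mk_path /path_concat_fun H0 K0.
- by move=> s; rewrite /= /mk_path /path_concat_fun H1 K1.
- move=> t /=; rewrite uval0_le uval1_le first_half0 second_half1.
  by rewrite (Hxy t).1 (Kyz t).2.
Qed.

Lemma path_rev_homotopic {x y : T} (p q : ipath x y) :
  path_homotopic p q -> path_homotopic (path_rev p) (path_rev q).
Proof.
move=> [H [cH H0 H1 Hxy]]; exists (fun st => H (urev st.1, st.2)); split.
- apply: comp_continuous cH; apply: pair_continuous _ snd_continuous.
  exact: comp_continuous fst_continuous urev_continuous.
- by move=> s /=; rewrite H0.
- by move=> s /=; rewrite H1.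
- by move=> t /=; rewrite urev0 urev1 (Hxy t).1 (Hxy t).2.
Qed.

Lemma path_concatA {x y z w : T} (p : ipath x y) (q : ipath y z)
    (r : ipath z w) :
  path_homotopic (path_concat p (path_concat q r))
    (path_concat (path_concat p q) r).
Proof.
apply: path_homotopic_sym.
pose k (u : R) := Num.min (2 * u) (Num.min (u + 4^-1) (2^-1 * u + 2^-1)).
have k1 (t : I) : k (uval t) = if uval t <= 4^-1 then 2 * uval t else
    if uval t <= 2^-1 then uval t + 4^-1 else 2^-1 * uval t + 2^-1.
  have tI := uval_itv t; rewrite /k; case: (leP (uval t) 4^-1) => ?;
    case: (leP (uval t) 2^-1) => ?; case: (leP (uval t + 4^-1)) => ?;
    case: leP => ?; lra.
have kI (t : I) : 0 <= k (uval t) <= 1.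
  by have tI := uval_itv t; rewrite k1; case: (leP (uval t) 4^-1) => ?;
    case: (leP (uval t) 2^-1) => ?; lra.
have kz : clamp (k (uval zero)) = zero.
  by rewrite k1 uval0 ifT ?mulr0 -?uval0 ?clamp_uval // uval0; lra.
have ko : clamp (k (uval one)) = one.
  rewrite k1 uval1 !ifF; try by apply/negP; lra.
  by rewrite (_ : _ + _ = 1) -?uval1 ?clamp_uval // uval1; lra.
apply: (@reparam_homotopic _ _ (path_concat p (path_concat q r))
  (fun t => clamp (k (uval t))) id).
- exact: cts_fun.
- apply: clamp_comp_continuous => u.
  have cl : {for u, continuous (fun u : R => 2^-1 * u + 2^-1)}.
    apply: cvgD; last exact: cvg_cst.
    by apply: cvgM; [exact: cvg_cst|exact: cvg_id].
  have cl2 : {for u, continuous (fun u : R => 2 * u)}.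
    by apply: cvgM; [exact: cvg_cst|exact: cvg_id].
  have cl3 : {for u, continuous (fun u : R => u + 4^-1)}.
    by apply: cvgD; [exact: cvg_id|exact: cvg_cst].
  by apply: continuous_min => //; apply: continuous_min.
- by move=> ?; exact: cvg_id.
- exact: kz.
- exact: ko.
- move=> t; have tI := uval_itv t.
  rewrite /= /mk_path /path_concat_fun /= /mk_path /path_concat_fun.
  have ev := k1 t; have vI := kI t.
  rewrite /first_half /second_half (uval_clamp_id vI).
  move: (k (uval t)) ev vI => v ev vI.
  have F (b : R) : b < uval t -> (uval t <= b) = false by move=> ?; apply/negP; lra.
  have G (a b : R) : b < a -> (a <= b) = false by move=> ?; apply/negP; lra.
  have [t4|t4] := leP (uval t) 4^-1; [|have [t2|t2] := leP (uval t) 2^-1].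
  + rewrite t4 in ev; have t2 : uval t <= 2^-1 by lra.
    have t2' : 2 * uval t <= 2^-1 by lra.
    by rewrite t2 ev (uval_clamp_id (r := 2 * _)) ?t2' //; lra.
  + rewrite F // t2 in ev; rewrite (uval_clamp_id (r := 2 * uval t)); last by lra.
    rewrite G; last by lra.
    rewrite [in RHS]G; last by lra.
    rewrite uval_clamp_id; last by lra.
    rewrite [in RHS]ifT; last by lra.
    by congr (q (clamp _)); lra.
  + rewrite F // F // in ev.
    rewrite [in RHS]G; last by lra.
    rewrite uval_clamp_id; last by lra.
    rewrite [in RHS]G; last by lra.
    by congr (r (clamp _)); lra.
- by [].
Qed.

Lemma path_concat1p {x y : T} (p : ipath x y) :
  path_homotopic (path_concat (path_cst x) p) p.
Proof.
apply: (@reparam_homotopic _ _ p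
  (fun t => if uval t <= 2^-1 then zero else second_half t) id).
- exact: cts_fun.
- apply: paste_continuous.
  + exact: uval_continuous.
  + exact: cst_continuous.
  + exact: second_half_continuous.
  + by move=> t /second_half_mid.
- by move=> ?; exact: cvg_id.
- by rewrite uval0_le.
- by rewrite uval1_le second_half1.
- move=> t; rewrite /= /mk_path /path_concat_fun /=.
  by case: ifP => // _; rewrite path_zero.
- by [].
Qed.

Lemma path_concatp1 {x y : T} (p : ipath x y) :
  path_homotopic (path_concat p (path_cst y)) p.
Proof.
apply: (@reparam_homotopic _ _ p
  (fun t => if uval t <= 2^-1 then first_half t else one) id).
- exact: cts_fun.
- apply: paste_continuous.
  + exact: uval_continuous.
  + exact: first_half_continuous.
  + exact: cst_continuous.
  + by move=> t /first_half_mid.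
- by move=> ?; exact: cvg_id.
- by rewrite uval0_le first_half0.
- by rewrite uval1_le.
- move=> t; rewrite /= /mk_path /path_concat_fun /=.
  by case: ifP => // _; rewrite path_one.
- by [].
Qed.

Lemma path_concatpV {x y : T} (p : ipath x y) :
  path_homotopic (path_concat p (path_rev p)) (path_cst x).
Proof.
apply: (@reparam_homotopic _ _ p
  (fun t => if uval t <= 2^-1 then first_half t else urev (second_half t))
  (cst zero)).
- exact: cts_fun.
- apply: paste_continuous.
  + exact: uval_continuous.
  + exact: first_half_continuous.
  + exact: comp_continuous second_half_continuous urev_continuous.
  + by move=> t e; rewrite first_half_mid // second_half_mid // urev0.
- exact: cst_continuous.
- by rewrite uval0_le first_half0.
- by rewrite uval1_le second_half1 urev1.
- by move=> t; rewrite /= /mk_path /path_concat_fun /=; case: ifP.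
- by move=> t; rewrite /= path_zero.
Qed.

Lemma path_concatVp {x y : T} (p : ipath x y) :
  path_homotopic (path_concat (path_rev p) p) (path_cst y).
Proof.
apply: (@reparam_homotopic _ _ p
  (fun t => if uval t <= 2^-1 then urev (first_half t) else second_half t)
  (cst one)).
- exact: cts_fun.
- apply: paste_continuous.
  + exact: uval_continuous.
  + exact: comp_continuous first_half_continuous urev_continuous.
  + exact: second_half_continuous.
  + by move=> t e; rewrite first_half_mid // second_half_mid // urev1.
- exact: cst_continuous.
- by rewrite uval0_le first_half0 urev0.
- by rewrite uval1_le second_half1.
- by move=> t; rewrite /= /mk_path /path_concat_fun /=; case: ifP.
- by move=> t; rewrite /= path_one.
Qed.

End Homotopy.

Section FundamentalGroup.
Context {R : realType} {T : topologicalType} (x : T).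
Local Notation loop := {path (unit_interval R) from x to x in T}.
Local Open Scope quotient_scope.

Definition loop_homotopicb (p q : loop) : bool := `[< path_homotopic p q >].

Lemma loop_homotopicb_refl : reflexive loop_homotopicb.
Proof. by move=> p; apply/asboolP; exact: path_homotopic_refl. Qed.

Lemma loop_homotopicb_sym : symmetric loop_homotopicb.
Proof.
by move=> p q; apply/asboolP/asboolP; exact: path_homotopic_sym.
Qed.

Lemma loop_homotopicb_trans : transitive loop_homotopicb.
Proof.
move=> q p r /asboolP pq /asboolP qr; apply/asboolP.
exact: path_homotopic_trans pq qr.
Qed.

Canonical loop_equiv :=
  EquivRel loop_homotopicb loop_homotopicb_refl loop_homotopicb_sym
    loop_homotopicb_trans.

Definition pi1 : Type := {eq_quot loop_equiv}.

HB.instance Definition _ := Choice.on pi1.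

Definition pi1_class (p : loop) : pi1 := \pi_({eq_quot loop_equiv}) p.

Definition pi1_repr (a : pi1) : loop := repr (a : {eq_quot loop_equiv}).

Lemma pi1_reprK (a : pi1) : pi1_class (pi1_repr a) = a.
Proof. exact: reprK. Qed.

Lemma pi1_classP (p q : loop) : pi1_class p = pi1_class q <-> path_homotopic p q.
Proof.
by split=> [/eqmodP/asboolP//|pq]; apply/eqmodP/asboolP.
Qed.

Lemma pi1_class_repr (p : loop) : path_homotopic (pi1_repr (pi1_class p)) p.
Proof. by apply/pi1_classP; rewrite pi1_reprK. Qed.

Definition pi1_one : pi1 := pi1_class (path_cst x).
Definition pi1_mul (a b : pi1) : pi1 :=
  pi1_class (path_concat (pi1_repr a) (pi1_repr b)).
Definition pi1_inv (a : pi1) : pi1 := pi1_class (path_rev (pi1_repr a)).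

Lemma pi1_mulE p q :
  pi1_mul (pi1_class p) (pi1_class q) = pi1_class (path_concat p q).
Proof.
by apply/pi1_classP; apply: path_concat_homotopic; exact: pi1_class_repr.
Qed.

Lemma pi1_invE p : pi1_inv (pi1_class p) = pi1_class (path_rev p).
Proof. by apply/pi1_classP; apply: path_rev_homotopic; exact: pi1_class_repr. Qed.

Lemma pi1_mulA : associative pi1_mul.
Proof.
move=> a b c; rewrite -(pi1_reprK a) -(pi1_reprK b) -(pi1_reprK c) !pi1_mulE.
by apply/pi1_classP; exact: path_concatA.
Qed.

Lemma pi1_mul1 : left_id pi1_one pi1_mul.
Proof.
move=> a; rewrite -(pi1_reprK a) pi1_mulE.
by apply/pi1_classP; exact: path_concat1p.
Qed.

Lemma pi1_mulr1 : right_id pi1_one pi1_mul.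
Proof.
move=> a; rewrite -(pi1_reprK a) pi1_mulE.
by apply/pi1_classP; exact: path_concatp1.
Qed.

Lemma pi1_mulV : left_inverse pi1_one pi1_inv pi1_mul.
Proof.
move=> a; rewrite -(pi1_reprK a) pi1_invE pi1_mulE.
by apply/pi1_classP; exact: path_concatVp.
Qed.

Lemma pi1_mulrV : right_inverse pi1_one pi1_inv pi1_mul.
Proof.
move=> a; rewrite -(pi1_reprK a) pi1_invE pi1_mulE.
by apply/pi1_classP; exact: path_concatpV.
Qed.

HB.instance Definition _ :=
  isGroup.Build pi1 pi1_mulA pi1_mul1 pi1_mulr1 pi1_mulV pi1_mulrV.

End FundamentalGroup.
Arguments pi1 R {T} x.

Section HawaiianEarring.
Context (R : realType).

Definition circle (c : R * R) (r : R) : set (R * R) :=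
  [set p | (p.1 - c.1) ^+ 2 + (p.2 - c.2) ^+ 2 = r ^+ 2].

Definition hawaiian_earring : set (R * R) :=
  \bigcup_(n in [set n | (1 <= n)%N]) circle (0, n%:R^-1) n%:R^-1.

Lemma hawaiian_earring_base : (0, 0) \in hawaiian_earring.
Proof. by rewrite inE; exists 1%N => //=; rewrite /circle /=; ring. Qed.

Definition hawaiian_base : set_type hawaiian_earring :=
  exist (fun p => p \in hawaiian_earring) _ hawaiian_earring_base.

(* The earring carries the subspace topology of the product topology on R * R,
   via the topology that the library puts on set_type. *)
Definition hawaiian_earring_group : groupType := pi1 R hawaiian_base.

End HawaiianEarring.

(* Between groups, {multiplicative _ -> _} is the type of group homomorphisms:
   preservation of 1 and of inverses follows. *)
Section GroupMorphism.
Local Open Scope group_scope.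
Context {G H : groupType} (f : {multiplicative G -> H}).

Lemma multiplicative1 : f 1 = 1.
Proof. by apply: (mulgI (f 1)); rewrite -gmulfM !mulg1. Qed.

Lemma multiplicativeV (x : G) : f x^-1 = (f x)^-1.
Proof. by apply: (mulgI (f x)); rewrite -gmulfM !mulgV multiplicative1. Qed.

End GroupMorphism.

Definition isomorphic (G H : groupType) : Prop :=
  exists f : {multiplicative G -> H}, bijective f.

Definition homomorphic_image (Q G : groupType) : Prop :=
  exists f : {multiplicative G -> Q}, range f = [set: Q].

Definition embeds (Q G : groupType) : Prop :=
  exists f : {multiplicative Q -> G}, injective f.

(* Only the values of f on X matter: phi is the unique homomorphism that
   extends f restricted to X. *)
Definition free_basis (G : groupType) (X : set G) : Prop :=
  forall (H : groupType) (f : G -> H),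
    (exists phi : {multiplicative G -> H}, {in X, phi =1 f}) /\
    (forall phi psi : {multiplicative G -> H}, {in X, phi =1 psi} -> phi =1 psi).

Definition free_group (G : groupType) : Prop := exists X : set G, free_basis X.

(* J is an arbitrary partially ordered set, not necessarily directed. *)
Record inverse_system (d : Order.disp_t) (J : porderType d) := InverseSystem {
  is_obj :> J -> groupType;
  is_map : forall a b : J, (b <= a)%O -> {multiplicative is_obj a -> is_obj b};
  is_mapA : forall (a b c : J) (ba : (b <= a)%O) (cb : (c <= b)%O)
    (ca : (c <= a)%O) (g : is_obj a),
    is_map cb (is_map ba g) = is_map ca g
}.

Arguments is_map {d J} i {a b} ba.

Section InverseLimit.
Context {d : Order.disp_t} {J : porderType d} (F : inverse_system J).

Record inverse_limit := InverseLimit {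
  il_fun :> forall a, F a;
  il_compat : forall (a b : J) (ba : (b <= a)%O),
    il_fun b = is_map F ba (il_fun a)
}.

Lemma inverse_limit_eq (f g : inverse_limit) : (forall a, f a = g a) -> f = g.
Proof.
case: f g => [f cf] [g cg] /= fg.
have {}fg : f = g by apply: functional_extensionality_dep.
by case: _ / fg cg => cg; congr InverseLimit; exact: Prop_irrelevance.
Qed.

HB.instance Definition _ := gen_eqMixin inverse_limit.
HB.instance Definition _ := gen_choiceMixin inverse_limit.

Local Open Scope group_scope.

Lemma il_one_compat (a b : J) (ba : (b <= a)%O) : 1 = is_map F ba 1.
Proof. by rewrite multiplicative1. Qed.

Lemma il_mul_compat (f g : inverse_limit) (a b : J) (ba : (b <= a)%O) :
  f b * g b = is_map F ba (f a * g a).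
Proof. by rewrite gmulfM -!il_compat. Qed.

Lemma il_inv_compat (f : inverse_limit) (a b : J) (ba : (b <= a)%O) :
  (f b)^-1 = is_map F ba (f a)^-1.
Proof. by rewrite multiplicativeV -il_compat. Qed.

Definition il_one := @InverseLimit (fun a => 1) il_one_compat.
Definition il_mul (f g : inverse_limit) :=
  @InverseLimit (fun a => f a * g a) (il_mul_compat f g).
Definition il_inv (f : inverse_limit) :=
  @InverseLimit (fun a => (f a)^-1) (il_inv_compat f).

Lemma il_mulA : associative il_mul.
Proof. by move=> f g h; apply: inverse_limit_eq => a /=; rewrite mulgA. Qed.

Lemma il_mul1 : left_id il_one il_mul.
Proof. by move=> f; apply: inverse_limit_eq => a /=; rewrite mul1g. Qed.

Lemma il_mulr1 : right_id il_one il_mul.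
Proof. by move=> f; apply: inverse_limit_eq => a /=; rewrite mulg1. Qed.

Lemma il_mulV : left_inverse il_one il_inv il_mul.
Proof. by move=> f; apply: inverse_limit_eq => a /=; rewrite mulVg. Qed.

Lemma il_mulrV : right_inverse il_one il_inv il_mul.
Proof. by move=> f; apply: inverse_limit_eq => a /=; rewrite mulgV. Qed.

HB.instance Definition _ :=
  isGroup.Build inverse_limit il_mulA il_mul1 il_mulr1 il_mulV il_mulrV.

End InverseLimit.

Definition embeds_in_inverse_limit_of_free_groups (Q : groupType) : Prop :=
  exists (d : Order.disp_t) (J : porderType d) (F : inverse_system J),
    (forall a, free_group (F a)) /\ embeds Q (inverse_limit F).

(* Main.v *)
Require Import Defs.
From HB Require Import structures.
From mathcomp Require Import all_boot all_order all_algebra fingroup perm.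
From mathcomp Require Import ring lra.
From mathcomp Require Import all_classical all_reals topology normedtype homotopy.

(** The group [Q] is the image of the homomorphism from the Hawaiian earring
group to the product of countably many copies of the integers that records, for
each circle, how many times a loop winds around it.

It is a homomorphic image of the earring group by construction, and it lies in
a product of copies of the free group of rank one.  Such a product is an inverse
limit of free groups: the index poset may be an antichain, and then there are
no connecting maps to respect ([Zsystem]).  For every sequence of bits there is
a loop that goes once around exactly the circles selected by the bits
([tour_loop]); it is continuous because all but finitely many of its laps stay
in a given neighbourhood of the base point.  Distinct bit sequences give
distinct winding sequences, so [Q] is uncountable.

As [Q] is abelian and uncountable it is not free: two elements of a basis
could be sent to two permutations that do not commute, so a basis has at most
one element, which would make [Q] countable
([abelian_uncountable_not_free]).  As [Q] is abelian it is not isomorphic to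
the earring group either, for that one is not abelian: some homomorphism to a
symmetric group sends the loops around the first two circles to
noncommuting permutations ([hawaiian_group_noncommutative]).

All homomorphisms out of the fundamental group come from one construction
([holonomy_hom]).  Let [c] assign a group element to each pair of points, so
that [c x y * c y z = c x z] as long as the points stay in a small enough
neighbourhood of a given point.  Multiplying [c] over consecutive points of a
fine subdivision of a loop gives a product that depends neither on the
subdivision nor on the loop within its homotopy class.  On the earring, [c]
detects passages through the top of a circle ([crossing]). *)

Set Implicit Arguments.
Unset Strict Implicit.
Unset Printing Implicit Defensive.

Import Order.TTheory GRing.Theory Num.Theory.
Import numFieldNormedType.Exports.

Local Open Scope classical_set_scope.
Local Open Scope ring_scope.

(** * Products along a chain of points *)

Section Chain.
Context {T : Type} {G : groupType} (c : T -> T -> G).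
Local Open Scope group_scope.
Implicit Types x y : nat -> T.

Fixpoint chain x n : G :=
  if n is m.+1 then chain x m * c (x m) (x m.+1) else 1.

Lemma eq_chain x y n :
  (forall i, (i <= n)%N -> x i = y i) -> chain x n = chain y n.
Proof.
elim: n => //= n IH xy.
by rewrite IH ?xy // => i /leqW; exact: xy.
Qed.

Lemma chain_add x m n :
  chain x (m + n) = chain x m * chain (fun i => x (m + i)%N) n.
Proof.
elim: n => [|n IH] /=; first by rewrite addn0 mulg1.
by rewrite addnS /= IH mulgA.
Qed.

(** Refinement: if the cocycle identity holds at every midpoint, then the odd
terms can be dropped. *)
Lemma chain_double x n :
    (forall i, (i < n)%N ->
      c (x i.*2) (x i.*2.+1) * c (x i.*2.+1) (x i.*2.+2) = c (x i.*2) (x i.*2.+2)) ->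
  chain x n.*2 = chain (fun i => x i.*2) n.
Proof.
elim: n => //= n IH xc.
by rewrite -mulgA xc // IH // => i /ltnW; exact: xc.
Qed.

(** Two parallel chains with commuting squares between them: the squares are
swept one by one, so the two chains differ only by their end rungs. *)
Lemma chain_ladder x y n :
    (forall i, (i < n)%N ->
      c (x i) (x i.+1) * c (x i.+1) (y i.+1) = c (x i) (y i) * c (y i) (y i.+1)) ->
  chain x n * c (x n) (y n) = c (x 0%N) (y 0%N) * chain y n.
Proof.
elim: n => [|n IH] xy /=; first by rewrite mul1g mulg1.
by rewrite -mulgA xy // mulgA IH ?mulgA // => i /ltnW; exact: xy.
Qed.

Lemma chain_telescope (k : nat -> G) x n :
    (forall i, (i < n)%N -> c (x i) (x i.+1) = (k i)^-1 * k i.+1) ->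
  chain x n = (k 0%N)^-1 * k n.
Proof.
elim: n => [|n IH] xk /=; first by rewrite mulVg.
by rewrite xk // IH; [rewrite mulgA mulgK|move=> i /ltnW; exact: xk].
Qed.

End Chain.

(** * Dyadic subdivisions *)

Section Dyadic.
Context {R : realType}.

Definition dyadic (n i : nat) : R := i%:R / 2 ^+ n.

Lemma dyadic0 n : dyadic n 0 = 0.
Proof. by rewrite /dyadic mul0r. Qed.

Lemma dyadic_full n : dyadic n (2 ^ n) = 1.
Proof. by rewrite /dyadic natrX divff // expf_neq0 // pnatr_eq0. Qed.

Lemma dyadicS n i : dyadic n i.+1 = dyadic n i + (2 ^+ n)^-1.
Proof. by rewrite /dyadic -natr1 mulrDl mul1r. Qed.

Lemma dyadic_double n i : dyadic n.+1 i.*2 = dyadic n i.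
Proof.
by rewrite /dyadic -muln2 natrM exprSr invfM mulrACA divff ?mulr1 // pnatr_eq0.
Qed.

Lemma dyadic_half n i : 2 * dyadic n.+1 i = dyadic n i.
Proof.
by rewrite /dyadic exprS invfM mulrCA mulVKf // pnatr_eq0.
Qed.

Lemma dyadic_unit n i : (i <= 2 ^ n)%N -> 0 <= dyadic n i <= 1.
Proof.
move=> le_i; rewrite divr_ge0 ?exprn_ge0 //= ler_pdivrMr ?exprn_gt0 //.
by rewrite mul1r -natrX ler_nat.
Qed.

Lemma dyadic_step_small (e : R) :
  0 < e -> exists N, forall n, (N <= n)%N -> (2 ^+ n)^-1 < e.
Proof.
move=> e0; exists (Num.bound e^-1) => n le_n.
rewrite invf_plt ?posrE ?exprn_gt0 //.
apply: lt_le_trans (archi_boundP _) _; first by rewrite invr_ge0 ltW.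
apply: le_trans (_ : n%:R <= _); first by rewrite ler_nat.
by rewrite -natrX ler_nat ltnW // ltn_expl.
Qed.

End Dyadic.

(** * Holonomy of a local cocycle *)

Section Holonomy.
Context {R : realType} {T : topologicalType} {G : groupType} (c : T -> T -> G).
Local Notation I := (unit_interval R).
Local Open Scope group_scope.

Definition cocycle_on (A : set T) : Prop :=
  forall x y z, A x -> A y -> A z -> c x y * c y z = c x z.

(** The cocycle identity is local, so [c] is locally a coboundary but the product
along a loop can be nontrivial. *)
Definition local_cocycle : Prop :=
  forall w : T, exists2 U, nbhs w U & cocycle_on U.

Hypothesis c_local : local_cocycle.

Lemma local_cocycle_diag w : c w w = 1.
Proof.
have [U wU cU] := c_local w; have Uw := nbhs_singleton wU.
by apply: (mulgI (c w w)); rewrite mulg1 cU.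
Qed.

(** The Lebesgue number lemma for the cover of a compact set by preimages of
neighbourhoods on which [c] is a cocycle. *)
Lemma cocycle_lebesgue (M : pseudoMetricType R) (K : set M) (f : M -> T) :
    compact K -> continuous f ->
  exists2 e : R, (0 < e)%R & forall x, K x -> cocycle_on (f @` ball x e).
Proof.
move=> /compact_near_coveringP Kc cf.
have : \forall e \near 0^'+, K `<=` (fun x => cocycle_on (f @` ball x e)).
  apply: (Kc R (0^'+) (fun e x => cocycle_on (f @` ball x e))) => x Kx.
  have [U xU cU] := c_local (f x).
  have /nbhs_ballP[e /= e0 eU] : nbhs x (f @^-1` U) by exact: cf.
  exists (ball x (e / 2)%R, `]0, e / 2[%classic)%R => /=.
    split; first by apply: nbhsx_ballx; rewrite divr_gt0.
    by near=> d; rewrite /= in_itv /=; apply/andP; split; near: d;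
      [exact: nbhs_right_gt|apply: nbhs_right_lt; rewrite divr_gt0].
  move=> [y d] /= [xy]; rewrite in_itv /= => /andP[d0 de].
  have yU z : ball y d z -> U (f z).
    move=> yz; apply: eU; rewrite [e]splitr; apply: ball_triangle xy _.
    by apply: le_ball yz; exact: ltW.
  by move=> _ _ _ [a ya <-] [b yb <-] [z yz <-]; apply: cU; exact: yU.
move=> nK.
have [e [e0 Ke]] := filter_ex (filterI (nbhs_right_gt (0 : R)%R) nK).
by exists e.
Unshelve. all: by end_near. Qed.

Definition sample (f : R -> T) n : nat -> T := fun i => f (dyadic n i).

(** The products over dyadic subdivisions are eventually equal to [g].  Dyadic
levels make concatenation exact: level [n.+1] of a concatenation is level [n]
of each of the two paths. *)
Definition holonomy_is (f : R -> T) (g : G) : Prop :=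
  exists N, forall n, (N <= n)%N -> chain c (sample f n) (2 ^ n) = g.

Lemma holonomy_unique f g g' : holonomy_is f g -> holonomy_is f g' -> g = g'.
Proof.
move=> [N fg] [N' fg'].
by rewrite -(fg (maxn N N')) ?leq_maxl // fg' // leq_maxr.
Qed.

Definition cell n i : set R := `[dyadic n i, dyadic n i.+1]%classic.

(** Stated for maps on the square because homotopies need it; a path is the
special case of a map that ignores its second argument. *)
Lemma cocycle_grid (H : R * R -> T) : continuous H ->
  exists N, forall n, (N <= n)%N -> forall i j, (i < 2 ^ n)%N -> (j < 2 ^ n)%N ->
    cocycle_on (H @` (cell n i `*` cell n j)).
Proof.
move=> cH.
have [e e0 He] := cocycle_lebesgue
  (compact_setX (@segment_compact R 0 1) (@segment_compact R 0 1)) cH.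
have [N Ne] := dyadic_step_small e0; exists N => n le_n i j lt_i lt_j.
have itv k : (k < 2 ^ n)%N -> `[0%R, 1%R]%classic (dyadic n k : R).
  by move=> /ltnW le_k; rewrite /= in_itv /= dyadic_unit.
have near_step k s : cell n k s -> ball (dyadic n k : R) e s.
  rewrite /cell /= in_itv /= dyadicS => /andP[s1 s2].
  rewrite /ball /= distrC ger0_norm ?subr_ge0 //.
  by rewrite ltrBlDl; apply: le_lt_trans s2 _; rewrite ltrD2l Ne.
have Hc := He (dyadic n i, dyadic n j) (conj (itv _ lt_i) (itv _ lt_j)).
move=> _ _ _ [p [p1 p2] <-] [q [q1 q2] <-] [r [r1 r2] <-].
by apply: Hc; [exists p|exists q|exists r] => //; split; exact: near_step.
Qed.

Lemma cell_left n i : cell n i (dyadic n i).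
Proof.
by rewrite /cell /= in_itv /= lexx dyadicS lerDl invr_ge0 exprn_ge0.
Qed.

Lemma cell_right n i : cell n i (dyadic n i.+1).
Proof.
by rewrite /cell /= in_itv /= lexx dyadicS lerDl invr_ge0 exprn_ge0.
Qed.

Lemma cell_mid n i : cell n i (dyadic n.+1 i.*2.+1).
Proof.
rewrite /cell /= in_itv /= -!(dyadic_double n) doubleS !dyadicS.
by rewrite !lerDl invr_ge0 exprn_ge0.
Qed.

(** At fine levels each subdivision step inserts a midpoint into a cell on which
[c] is a cocycle, so the product no longer changes. *)
Lemma holonomy_exists f : continuous f -> exists g, holonomy_is f g.
Proof.
move=> cf; have [N HN] := cocycle_grid (comp_continuous fst_continuous cf).
exists (chain c (sample f N) (2 ^ N)), N => n /subnKC <-.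
elim: (n - N)%N => [|m IH]; first by rewrite addn0.
rewrite addnS -[RHS]IH expnS mul2n chain_double.
  by apply: eq_chain => i _; rewrite /sample dyadic_double.
move=> i lt_i.
have lt0 : (0 < 2 ^ (N + m))%N by rewrite expn_gt0.
have fcell s : cell (N + m)%N i s ->
    ((f \o fst) @` (cell (N + m)%N i `*` cell (N + m)%N 0)) (f s).
  by move=> si; exists (s, dyadic (N + m)%N 0) => //; split=> //; exact: cell_left.
apply: (HN (N + m)%N (leq_addr _ _) i 0%N lt_i lt0); apply: fcell.
- by rewrite dyadic_double; exact: cell_left.
- exact: cell_mid.
- by rewrite -doubleS dyadic_double; exact: cell_right.
Qed.

(** Paths are extended to the real line by clamping, so that the dyadic points
can be taken in the line. *)
Definition loop_fun {x y : T} (p : {path I from x to y in T}) : R -> T :=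
  fun t => p (clamp t).

Lemma loop_fun_continuous {x y : T} (p : {path I from x to y in T}) :
  continuous (loop_fun p).
Proof. by apply: comp_continuous clamp_continuous _; exact: cts_fun. Qed.

Lemma clamp0 : clamp (0 : R) = zero.
Proof. by rewrite -uval0 clamp_uval. Qed.

Lemma clamp1 : clamp (1 : R) = one.
Proof. by rewrite -uval1 clamp_uval. Qed.

(** Subdivide the square of the homotopy finely: consecutive rows form a ladder
with commuting squares, and its end rungs are trivial because the homotopy fixes
the endpoints. *)
Lemma holonomy_homotopic {x y : T} (p q : {path I from x to y in T}) g :
  path_homotopic p q -> holonomy_is (loop_fun p) g -> holonomy_is (loop_fun q) g.
Proof.
move=> [H [cH H0 H1 Hxy]] [N pg].
pose K (st : R * R) : T := H (clamp st.1, clamp st.2).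
have cK : continuous K.
  apply: comp_continuous cH; apply: pair_continuous.
    exact: comp_continuous fst_continuous clamp_continuous.
  exact: comp_continuous snd_continuous clamp_continuous.
have [N' KN] := cocycle_grid cK.
exists (maxn N N') => n; rewrite geq_max => /andP[le_n le_n'].
rewrite -(pg n le_n).
have row j : (j <= 2 ^ n)%N ->
    chain c (sample (fun s => K (s, dyadic n j)) n) (2 ^ n) =
    chain c (sample (loop_fun p) n) (2 ^ n).
  elim: j => [|j IH] lt_j.
    by apply: eq_chain => i _; rewrite /sample /K /= dyadic0 clamp0 H0.
  rewrite -[RHS]IH ?(ltnW lt_j) //.
  have /chain_ladder : forall i, (i < 2 ^ n)%N ->
      let a i := sample (fun s => K (s, dyadic n j)) n i in
      let b i := sample (fun s => K (s, dyadic n j.+1)) n i in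
      c (a i) (a i.+1) * c (a i.+1) (b i.+1) = c (a i) (b i) * c (b i) (b i.+1).
    move=> i lt_i /=; have Kc := KN n le_n' i j lt_i lt_j.
    have corner s t : cell n i s -> cell n j t -> (K @` (cell n i `*` cell n j)) (K (s, t)).
      by move=> si tj; exists (s, t).
    by rewrite !Kc //; apply: corner; (exact: cell_left || exact: cell_right).
  rewrite /sample /K /= dyadic0 dyadic_full clamp0 clamp1.
  by rewrite !(Hxy _).1 !(Hxy _).2 !local_cocycle_diag mul1g mulg1.
rewrite -(row (2 ^ n)%N (leqnn _)).
by apply: eq_chain => i _; rewrite /sample /K /= dyadic_full clamp1 H1.
Qed.

Lemma holonomy_concat {x y z : T} (p : {path I from x to y in T})
    (q : {path I from y to z in T}) g h :
  holonomy_is (loop_fun p) g -> holonomy_is (loop_fun q) h ->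
  holonomy_is (loop_fun (path_concat p q)) (g * h).
Proof.
move=> [N pg] [N' qh]; exists (maxn N N').+1 => [[//|n]].
rewrite ltnS geq_max => /andP[le_n le_n'].
rewrite expnS mul2n -addnn chain_add -(pg n le_n) -(qh n le_n').
have half : dyadic n.+1 (2 ^ n) = 2^-1%R :> R.
  apply: (@mulfI _ 2%R); first by rewrite pnatr_eq0.
  by rewrite dyadic_half dyadic_full divff ?pnatr_eq0.
have unitS i : (i <= 2 ^ n.+1)%N -> uval (clamp (dyadic n.+1 i : R)) = dyadic n.+1 i.
  by move=> le_i; rewrite uval_clamp_id ?dyadic_unit.
congr (_ * _); apply: eq_chain => i le_i.
  rewrite /sample /loop_fun /= /mk_path /path_concat_fun /first_half.
  rewrite unitS ?dyadic_half; last by rewrite expnS mul2n -addnn (leq_trans le_i) ?leq_addr.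
  by rewrite -half ifT // ler_pM2r ?ler_nat ?invr_gt0 ?exprn_gt0.
have split_i : dyadic n.+1 (2 ^ n + i) = (2^-1 + dyadic n.+1 i)%R :> R.
  by rewrite -half /dyadic natrD mulrDl.
rewrite /sample /loop_fun /= /mk_path /path_concat_fun /first_half /second_half.
rewrite unitS; last by rewrite expnS mul2n -addnn leq_add2l.
have -> : (2 * dyadic n.+1 (2 ^ n + i)%N - 1 = dyadic n i :> R)%R.
  by rewrite split_i mulrDr dyadic_half mulfV ?pnatr_eq0 // addrAC subrr add0r.
rewrite split_i gerDl; case: i le_i {split_i} => [|i] le_i.
  (* At the middle time the definition of concatenation uses the first path. *)
  rewrite !dyadic0 lexx addr0 mulfV ?pnatr_eq0 // clamp0 clamp1.
  by rewrite path_one path_zero.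
by rewrite ifF // leNgt divr_gt0 ?exprn_gt0.
Qed.

(** Holonomy is multiplicative under concatenation and invariant under homotopy,
hence a homomorphism on the fundamental group. *)
Lemma holonomy_hom (x : T) :
  exists phi : {multiplicative pi1 R x -> G},
    forall p g, holonomy_is (loop_fun p) g -> phi (pi1_class p) = g.
Proof.
pose phi (a : pi1 R x) : G :=
  projT1 (cid (holonomy_exists (@loop_fun_continuous _ _ (pi1_repr a)))).
have phiP a : holonomy_is (loop_fun (pi1_repr a)) (phi a).
  by rewrite /phi; case: cid.
have phi_class p g : holonomy_is (loop_fun p) g -> phi (pi1_class p) = g.
  move=> pg; apply: (holonomy_unique (phiP _)).
  apply: holonomy_homotopic pg.
  by apply: path_homotopic_sym; exact: pi1_class_repr.
have phiM : {morph phi : a b / a * b}.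
  by move=> a b; apply: phi_class; apply: holonomy_concat.
pose phiH := isMultiplicative.Build _ _ phi phiM.
pose phi' : {multiplicative pi1 R x -> G} := HB.pack phi phiH.
by exists phi'.
Qed.

(** If [c] is a coboundary along [f] then the product telescopes.  The function
[k] plays the role of a lift of [f] to the covering space that belongs to [c]. *)
Lemma holonomy_lift (f : R -> T) (k : R -> G) (e : R) : (0 < e)%R ->
    (forall s t, (0 <= s)%R -> (s <= t)%R -> (t <= 1)%R -> (t - s < e)%R ->
      c (f s) (f t) = (k s)^-1 * k t) ->
  holonomy_is f ((k 0%R)^-1 * k 1%R).
Proof.
move=> e0 fk; have [N Ne] := dyadic_step_small e0; exists N => n le_n.
rewrite (@chain_telescope _ _ c (fun i => k (dyadic n i))).
  by rewrite dyadic0 dyadic_full.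
move=> i lt_i; have /andP[i0 _] : (0 <= (dyadic n i : R) <= 1)%R.
  by rewrite dyadic_unit // ltnW.
have /andP[_ i1] : (0 <= (dyadic n i.+1 : R) <= 1)%R by rewrite dyadic_unit.
apply: fk => //; first by rewrite dyadicS lerDl invr_ge0 exprn_ge0.
by rewrite dyadicS addrC addKr Ne.
Qed.

End Holonomy.

(** * A cocycle on the earring *)

Section EarringCocycle.
Context {R : realType}.
Local Notation E := (set_type (@hawaiian_earring R)).

Definition pt (x : E) : R * R := \val x.

Lemma pt_continuous : continuous pt.
Proof. exact: initial_continuous. Qed.

(** Inversion in the unit circle sends the circle of radius [1 / n] of the
earring to the horizontal line at height [n / 2]; this is twice the height of the
inverse of [p], so it recovers [n] from a point other than the base point. *)
Definition curvature (p : R * R) : R := 2 * p.2 / (p.1 ^+ 2 + p.2 ^+ 2).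

(** On a circle of the earring this is the open upper half. *)
Definition upper (p : R * R) : bool := `|p.1| < p.2.

Lemma upper_gt0 p : upper p -> 0 < p.2.
Proof. by move=> /(le_lt_trans (normr_ge0 _)). Qed.

Lemma sqr_sum_gt0 (a b : R) : b != 0 -> 0 < a ^+ 2 + b ^+ 2.
Proof. by move=> b0; rewrite ltr_wpDl ?sqr_ge0 // exprn_even_gt0. Qed.

Lemma earring_curvature (x : E) : (pt x).2 != 0 ->
  0 < (pt x).2 /\ exists n : nat, curvature (pt x) = n%:R.
Proof.
move=> x0; have := valP x; rewrite inE -/(pt x) => -[n /= n1]; rewrite /circle /=.
rewrite /curvature; move: (pt x) x0 => [a b] /= b0.
have n0 : 0 < n%:R :> R by rewrite ltr0n.
move=> ab; have D0 := sqr_sum_gt0 a b0.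
have abD : a ^+ 2 + b ^+ 2 = 2 * b / n%:R.
  transitivity ((a - 0) ^+ 2 + (b - n%:R^-1) ^+ 2 - n%:R^-1 ^+ 2 + 2 * b / n%:R).
    by field; rewrite gt_eqF.
  by rewrite ab subrr add0r.
split; last by exists n; rewrite abD; field; rewrite b0 gt_eqF.
by move: D0; rewrite abD pmulr_lgt0 ?invr_gt0 // pmulr_rgt0.
Qed.

(** Upper points close to the base point lie on circles of large curvature. *)
Lemma curvature_large (p : R * R) : upper p -> p.2^-1 < curvature p.
Proof.
move=> up; have p2 := upper_gt0 up.
have lt_sq : p.1 ^+ 2 < p.2 ^+ 2.
  by rewrite -(real_normK (num_real p.1)) ltr_pXn2r // nnegrE // ltW.
have D0 : 0 < p.1 ^+ 2 + p.2 ^+ 2 by apply: sqr_sum_gt0; rewrite gt_eqF.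
rewrite /curvature ltr_pdivlMr // ltr_pdivrMl //.
by rewrite mulrCA -expr2; lra.
Qed.

Lemma curvature_continuous (p : R * R) :
  p.2 != 0 -> {for p, continuous curvature}.
Proof.
move=> p0; apply: cvgM.
  by apply: cvgM; [exact: cvg_cst|exact: cvg_snd].
apply: cvgV; first by rewrite gt_eqF ?sqr_sum_gt0.
by apply: cvgD; apply: cvgM; first [exact: cvg_fst|exact: cvg_snd].
Qed.

Context {G : groupType} (g : R -> G).
Local Open Scope group_scope.

(** On the upper half of a circle this potential jumps at the top, from [1] on
the left to the label of the circle on the right; [crossing] is its coboundary on
each upper half and trivial elsewhere. *)
Definition side (p : R * R) : G := if (p.1 < 0)%R then 1 else g (curvature p).

Definition crossing (x y : E) : G :=
  let p := pt x in let q := pt y in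
  if [&& upper p, upper q & curvature p == curvature q]
  then (side p)^-1 * side q else 1.

Lemma pt_near (w : E) (V : set (R * R)) :
  nbhs (pt w) V -> nbhs w [set x : E | V (pt x)].
Proof. exact: (@pt_continuous w). Qed.

Lemma pt1_near (w : E) (V : set R) :
  nbhs (pt w).1 V -> nbhs w [set x : E | V (pt x).1].
Proof.
by move=> wV; apply: (@pt_near _ [set p | V p.1]); exact: (@fst_continuous R R).
Qed.

Lemma pt2_near (w : E) (V : set R) :
  nbhs (pt w).2 V -> nbhs w [set x : E | V (pt x).2].
Proof.
by move=> wV; apply: (@pt_near _ [set p | V p.2]); exact: (@snd_continuous R R).
Qed.

Lemma trivial_cocycle (U : set E) :
  (forall x y, U x -> U y -> crossing x y = 1) -> cocycle_on crossing U.
Proof. by move=> U1 x y z Ux Uy Uz; rewrite !U1 // mulg1. Qed.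

Lemma crossing_same_side (x y : E) :
  ((pt x).1 < 0)%R = ((pt y).1 < 0)%R -> crossing x y = 1.
Proof.
move=> xy; rewrite /crossing /side xy; case: ifP => // /and3P[_ _ /eqP ->].
by case: ifP; rewrite mulVg.
Qed.

(** Near a point off the vertical axis, no side change is possible.  Near the
top of a circle, the curvature is locally constant, being continuous with
integer values, so [crossing] is the coboundary of [side].  Near the base point
only circles of curvature above [B] have upper points, and these carry the
trivial label. *)
Lemma crossing_local (B : R) : (forall r, (B < r)%R -> g r = 1) ->
  local_cocycle crossing.
Proof.
move=> gB w; have [w0|w0] := eqVneq (pt w).1 0%R; last first.
  have [wl|wr|/eqP] := ltgtP (pt w).1 0%R; last by rewrite (negbTE w0).
  - exists [set x : E | (pt x).1 < 0]%R.
      by apply: (@pt1_near _ [set r | r < 0]%R); exact: lt_nbhsl.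
    apply: trivial_cocycle => x y /= x0 y0; apply: crossing_same_side.
    by rewrite x0 y0.
  - exists [set x : E | 0 < (pt x).1]%R.
      by apply: (@pt1_near _ [set r | 0 < r]%R); apply: open_nbhs_nbhs; split; [exact: open_gt|].
    apply: trivial_cocycle => x y /= x0 y0; apply: crossing_same_side.
    by rewrite !ltNge !ltW.
have [w2|w2] := eqVneq (pt w).2 0%R.
  have B0 : (0 < Num.max B 1)%R by rewrite lt_max ltr01 orbT.
  exists [set x : E | (pt x).2 < (Num.max B 1)^-1]%R.
    apply: (@pt2_near _ [set r | r < (Num.max B 1)^-1]%R).
    by apply: lt_nbhsl; rewrite w2 invr_gt0.
  have side1 (x : E) : ((pt x).2 < (Num.max B 1)^-1)%R -> upper (pt x) ->
      side (pt x) = 1.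
    move=> xB ux; rewrite /side; case: ifP => // _; apply: gB.
    apply: le_lt_trans (curvature_large ux).
    apply: le_trans (_ : (Num.max B 1 <= _)%R); first by rewrite le_max lexx.
    by rewrite -[leLHS]invrK lef_pV2 ?posrE ?invr_gt0 ?(upper_gt0 ux) // ltW.
  apply: trivial_cocycle => x y /= xB yB; rewrite /crossing.
  by case: ifP => // /and3P[ux uy _]; rewrite !side1 // mulVg.
have [w2_gt0 _] := earring_curvature w2.
exists [set x : E | upper (pt x) /\ `|curvature (pt w) - curvature (pt x)| < 2^-1]%R.
  apply: (@pt_near _ [set p | upper p /\ `|curvature (pt w) - curvature p| < 2^-1]%R).
  have near_upper : \forall p \near pt w, upper p.
    suff : \forall p \near pt w, (0 < p.2 - `|p.1|)%R.
      by apply: filterS => p; rewrite subr_gt0.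
    have cw : {for pt w, continuous (fun p : R * R => p.2 - `|p.1|)%R}.
      by apply: cvgB; [exact: cvg_snd|apply: cvg_norm; exact: cvg_fst].
    apply: (cw [set r | 0 < r]%R); apply: open_nbhs_nbhs; split.
      exact: open_gt.
    by rewrite /= w0 normr0 subr0.
  have near_curv : \forall p \near pt w, (`|curvature (pt w) - curvature p| < 2^-1)%R.
    by have /cvgrPdist_lt := curvature_continuous w2; apply; rewrite invr_gt0.
  exact: filterI near_upper near_curv.
have same (x y : E) : upper (pt x) -> upper (pt y) ->
    (`|curvature (pt w) - curvature (pt x)| < 2^-1)%R ->
    (`|curvature (pt w) - curvature (pt y)| < 2^-1)%R ->
    crossing x y = (side (pt x))^-1 * side (pt y).
  move=> ux uy xw yw; rewrite /crossing ux uy /= ifT //.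
  have [_ [i xi]] := earring_curvature (lt0r_neq0 (upper_gt0 ux)).
  have [_ [j yj]] := earring_curvature (lt0r_neq0 (upper_gt0 uy)).
  have : (`|curvature (pt x) - curvature (pt y)| < 1)%R.
    rewrite distrC in xw.
    by apply: le_lt_trans (ler_distD (curvature (pt w)) _ _) _; lra.
  rewrite xi yj eqr_nat; apply: contraLR; rewrite -leNgt.
  wlog lt_ij : i j {xi yj} / (i < j)%N => [W ij|_].
    move: (ij); rewrite neq_ltn => /orP[] lt_ij; first exact: W.
    by rewrite distrC W // eq_sym.
  rewrite distrC ger0_norm ?subr_ge0 ?ler_nat ?(ltnW lt_ij) //.
  by rewrite lerBrDr addrC natr1 ler_nat.
by move=> x y z [ux xw] [uy yw] [uz zw]; rewrite !same // mulgA mulgK.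
Qed.

End EarringCocycle.

(** * Loops that tour selected circles *)

Section CircleArc.
Context {R : realType}.
Implicit Types k r : R.

Definition arc_den k r : R := 4 * r ^+ 2 + k ^+ 2 * (1 - r ^+ 2) ^+ 2.

(** The image under inversion in the unit circle of the point of abscissa
[r / (1 - r ^+ 2)] on the line at height [k / 2], for [r] between [-1] and [1].
The fraction is cleared of [1 - r ^+ 2], so that the endpoints [r = -1] and
[r = 1] give the base point. *)
Definition arc k r : R * R :=
  (4 * r * (1 - r ^+ 2) / arc_den k r, 2 * k * (1 - r ^+ 2) ^+ 2 / arc_den k r).

Lemma arc_den_gt0 k r : 0 < k -> 0 < arc_den k r.
Proof.
move=> k0; rewrite /arc_den; have [->|r0] := eqVneq r 0.
  by rewrite expr0n /= mulr0 add0r subr0 expr1n mulr1 exprn_gt0.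
apply: ltr_wpDr; first by rewrite mulr_ge0 ?sqr_ge0.
by rewrite mulr_gt0 // exprn_even_gt0.
Qed.

Lemma arc_end k r : r ^+ 2 = 1 -> arc k r = (0, 0).
Proof. by move=> r1; rewrite /arc r1 subrr expr0n /= !mulr0 !mul0r. Qed.

Lemma arc_sqr_sum k r : 0 < k ->
  (arc k r).1 ^+ 2 + (arc k r).2 ^+ 2 = 2 * (arc k r).2 / k.
Proof.
move=> k0; have D0 := arc_den_gt0 r k0; rewrite /arc /=.
move: D0; rewrite /arc_den => D0; field; by rewrite !gt_eqF // exprMn.
Qed.

Lemma arc_on_circle k r : 0 < k -> circle (0, k^-1) k^-1 (arc k r).
Proof.
move=> k0; rewrite /circle; have := arc_sqr_sum r k0.
case: (arc k r) => a b /= ab.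
have -> : k^-1 ^+ 2 = a ^+ 2 + b ^+ 2 - 2 * b / k + k^-1 ^+ 2.
  by rewrite ab subrr add0r.
by rewrite subr0; field; rewrite gt_eqF.
Qed.

Lemma arc_curvature k r : 0 < k -> r ^+ 2 < 1 -> curvature (arc k r) = k.
Proof.
move=> k0 r1; rewrite /curvature arc_sqr_sum //.
have : 0 < (arc k r).2.
  rewrite /arc /= divr_gt0 ?arc_den_gt0 //.
  by apply: mulr_gt0; [exact: mulr_gt0|apply: exprn_gt0; rewrite subr_gt0].
by move=> a0; field; rewrite !gt_eqF.
Qed.

Lemma arc_left k r : 0 < k -> r ^+ 2 < 1 -> ((arc k r).1 < 0) = (r < 0).
Proof.
move=> k0 r1; rewrite /arc /= pmulr_llt0 ?invr_gt0 ?arc_den_gt0 //.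
by rewrite pmulr_llt0 ?subr_gt0 // pmulr_rlt0.
Qed.

(** The point is upper exactly when [2 * `|r| < k * (1 - r ^+ 2)]. *)
Lemma arc_upper k r : 1 <= k -> `|r| <= 4^-1 -> upper (arc k r).
Proof.
move=> k1; rewrite ler_norml => /andP[r1 r2]; have k0 := lt_le_trans ltr01 k1.
have D0 := arc_den_gt0 r k0.
rewrite /upper /arc /= normrM normfV (gtr0_norm D0) ltr_pM2r ?invr_gt0 //.
have q0 : 3 / 4 <= 1 - r ^+ 2 by nra.
move: (1 - _) q0 => q q0.
have kq : 3 / 4 <= k * q by nra.
have lt_l : 0 < q * (2 * (k * q) + 4 * r) by apply: mulr_gt0; lra.
have lt_r : 0 < q * (2 * (k * q) - 4 * r) by apply: mulr_gt0; lra.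
by rewrite ltr_norml; apply/andP; split; lra.
Qed.

Lemma arc_norm k r : 0 < k -> `|arc k r| <= 2 / k.
Proof.
move=> k0; have := arc_sqr_sum r k0; case: (arc k r) => a b /= ab.
have kV : 0 < k^-1 by rewrite invr_gt0.
rewrite prod_normE /= ge_max; move: ab kV; rewrite -!mulrA.
move: k^-1 => d ab d0.
have sqr_bound (c : R) : c ^+ 2 <= (2 * d) ^+ 2 -> `|c| <= 2 * d.
  by move=> c2; rewrite -ler_sqr ?nnegrE ?mulr_ge0 ?(ltW d0) // real_normK ?num_real.
have b2 : `|b| <= 2 * d.
  apply: sqr_bound; have := sqr_ge0 a; have := sqr_ge0 (2 * d - b); nra.
apply/andP; split=> //; apply: sqr_bound.
by have := sqr_ge0 (d - b); nra.
Qed.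

Lemma arc_continuous k : 0 < k -> continuous (arc k).
Proof.
move=> k0; have csqr : continuous (fun r : R => r ^+ 2).
  by apply: mulr_continuous => r; exact: cvg_id.
have cq : continuous (fun r : R => 1 - r ^+ 2).
  by apply: subr_continuous => // r; exact: cvg_cst.
have cD : continuous (arc_den k).
  apply: addr_continuous; apply: mulr_continuous => //; first by move=> r; exact: cvg_cst.
    by move=> r; exact: cvg_cst.
  exact: comp_continuous cq csqr.
have cDV : continuous (fun r => (arc_den k r)^-1).
  by move=> r; apply: cvgV; [rewrite gt_eqF // arc_den_gt0|exact: cD].
apply: pair_continuous; apply: mulr_continuous => //; apply: mulr_continuous => //.
- by apply: mulr_continuous => r; [exact: cvg_cst|exact: cvg_id].
- by move=> r; exact: cvg_cst.
- exact: comp_continuous cq csqr.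
Qed.

End CircleArc.

Section Tour.
Context {R : realType}.
Implicit Types (b : nat -> bool) (n m : nat) (s t : R).

(** Affine, and equal to [-1] at [1 / 2 ^+ n.+1] and to [1] at [1 / 2 ^+ n]: the
circle number [n], of curvature [n.+1], is run through between these two times. *)
Definition phase n t : R := 2 ^+ n.+2 * t - 3.

Definition lap n t : R * R := arc n.+1%:R (Num.max (-1) (Num.min 1 (phase n t))).

Lemma lap_active n t : `|phase n t| < 1 -> lap n t = arc n.+1%:R (phase n t).
Proof.
by rewrite ltr_norml /lap => /andP[p1 p2]; rewrite min_r ?max_r // ltW.
Qed.

Lemma lap_idle n t : 1 <= `|phase n t| -> lap n t = (0, 0).
Proof.
move=> p1; apply: arc_end; case: (ltP (phase n t) 0) p1 => p0.
  rewrite ltr0_norm // => p1; rewrite min_r; last by lra.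
  by rewrite max_l ?sqrrN ?expr1n //; lra.
rewrite ger0_norm // => p1; rewrite min_l // max_r ?expr1n //; lra.
Qed.

Lemma phase_continuous n : continuous (phase n).
Proof.
apply: subr_continuous; last by move=> t; exact: cvg_cst.
by apply: mulr_continuous => t; [exact: cvg_cst|exact: cvg_id].
Qed.

Lemma lap_continuous n : continuous (lap n).
Proof.
have cmm : continuous (fun r : R => Num.max (-1) (Num.min 1 r)).
  move=> r; apply: (@continuous_max R R (cst (-1)) (fun r => Num.min 1 r)).
    exact: cvg_cst.
  by apply: (@continuous_min R R (cst 1) id); [exact: cvg_cst|exact: cvg_id].
apply: comp_continuous (comp_continuous (@phase_continuous n) cmm) _.
by apply: arc_continuous; rewrite ltr0n.
Qed.

(** If [n < m] then phase [m] ends no later than phase [n] starts, both times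
being dyadic: [2 ^+ m.+2 * t] is below [4], while [2 ^+ n.+2 * t] is above [2]. *)
Lemma phase_disjoint n m t : `|phase n t| < 1 -> `|phase m t| < 1 -> n = m.
Proof.
wlog nm : n m / (n < m)%N => [W np mp|].
  by case: (ltngtP n m) => // lt; [exact: W|apply/esym; exact: W].
rewrite !ltr_norml /phase => /andP[n1 n2] /andP[m1 m2].
have t0 : 0 < t by rewrite -(pmulr_rgt0 t (exprn_gt0 n.+2 (ltr0n R 2))); lra.
have : 2 * 2 ^+ n.+2 * t <= 2 ^+ m.+2 * t.
  by rewrite ler_pM2r // -exprS ler_weXn2l // ler1n.
by move=> le_nm; exfalso; lra.
Qed.

(** The path that is at the base point except on the time intervals of the
selected circles, each of which it runs through once. *)
Definition tour b t : R * R :=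
  if pselect (exists n, b n && (`|phase n t| < 1)) is left h
  then lap (xchoose h) t else (0, 0).

Lemma tour_active b n t : b n -> `|phase n t| < 1 -> tour b t = lap n t.
Proof.
move=> bn nt; rewrite /tour; case: pselect => [h|[]]; last first.
  by exists n; rewrite bn.
have /andP[_ ht] := xchooseP h.
by rewrite (phase_disjoint nt ht).
Qed.

Lemma tourP b t :
  (exists n, [/\ b n, `|phase n t| < 1 & tour b t = arc n.+1%:R (phase n t)]) \/
  tour b t = (0, 0).
Proof.
have [[n /andP[bn nt]]|no] := pselect (exists n, b n && (`|phase n t| < 1)).
  by left; exists n; rewrite (tour_active bn nt) lap_active.
by right; rewrite /tour; case: pselect.
Qed.

Lemma tour_in_earring b t : tour b t \in @hawaiian_earring R.
Proof.
rewrite inE; have [[n [bn nt ->]]|->] := tourP b t.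
  by exists n.+1 => //; apply: arc_on_circle; rewrite ltr0n.
by have := @hawaiian_earring_base R; rewrite inE.
Qed.

(** Where a selected circle is being run through, the tour agrees locally with
[lap].  Elsewhere it is at the base point and nearby values are small: the large
circles are finitely many, and each of them is left continuously; the others are
small altogether.  This covers the time [0], where infinitely many laps accumulate. *)
Lemma tour_continuous b : continuous (tour b).
Proof.
move=> t.
have [[n /andP[bn nt]]|no] := pselect (exists n, b n && (`|phase n t| < 1)).
  have near_n : \forall s \near t, `|phase n s| < 1.
    have cn : {for t, continuous (fun s => `|phase n s|)}.
      by apply: cvg_norm; exact: phase_continuous.
    exact: (cn [set r | r < 1] (lt_nbhsl nt)).
  rewrite /continuous_at (tour_active bn nt).
  apply: cvg_trans (@lap_continuous n t); apply: near_eq_cvg.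
  by apply: filterS near_n => s /(tour_active bn) ->.
have idle n : b n -> lap n t = (0, 0).
  by move=> bn; apply: lap_idle; rewrite leNgt; apply/negP => nt; apply: no;
    exists n; rewrite bn.
rewrite /continuous_at; have -> : tour b t = 0 by rewrite /tour; case: pselect.
apply/cvgr0Pnorm_lt => e e0.
have near_small n : \forall s \near t, b n -> `|lap n s| < e.
  case bn: (b n); last by apply: filterE.
  have := @lap_continuous n t; rewrite /prop_for /continuous_at idle //.
  by move=> /cvgr0Pnorm_lt/(_ e e0); apply: filterS.
pose N := Num.bound (2 / e).
have near_all : \forall s \near t, forall n : 'I_N, b n -> `|lap n s| < e.
  pose small (n : 'I_N) : set R := [set s | b n -> `|lap n s| < e].
  exact: (@filter_forall _ _ small _ (nbhs_filter t) (fun n : 'I_N => near_small n)).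
apply: filterS near_all => s small.
have [[n [bn ns ->]]|->] := tourP b s; last by rewrite normr0.
rewrite -lap_active //; have [lt_n|le_N] := ltnP n N; first exact: (small (Ordinal lt_n)).
rewrite lap_active //.
have n0 : 0 < n.+1%:R :> R by rewrite ltr0n.
apply: le_lt_trans (arc_norm _ n0) _.
rewrite ltr_pdivrMr // mulrC -ltr_pdivrMr //.
apply: lt_le_trans (archi_boundP _) _; first by rewrite divr_ge0 // ltW.
by rewrite ler_nat ltnW // ltnS.
Qed.

Definition tour_point b (t : unit_interval R) : set_type (@hawaiian_earring R) :=
  exist (fun p => p \in @hawaiian_earring R) _ (tour_in_earring b (uval t)).

Lemma tour_point_continuous b : continuous (tour_point b).
Proof.
apply: continuous_comp_initial.
exact: comp_continuous uval_continuous (@tour_continuous b).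
Qed.

Lemma tour_idle b t : (forall n, 1 <= `|phase n t|) -> tour b t = (0, 0).
Proof. by move=> idle; have [[n [_ + _]]|//] := tourP b t; rewrite ltNge idle. Qed.

Lemma tour_point0 b : tour_point b zero = hawaiian_base R.
Proof.
apply: val_inj; rewrite /= uval0 tour_idle // => n.
by rewrite /phase mulr0 sub0r normrN ger0_norm ?ler1n.
Qed.

Lemma tour_point1 b : tour_point b one = hawaiian_base R.
Proof.
apply: val_inj; rewrite /= uval1 tour_idle // => n.
rewrite /phase mulr1; have : 2 ^+ 2 <= 2 ^+ n.+2 :> R by rewrite ler_weXn2l // ler1n.
by move=> le4; rewrite ler_normr; apply/orP; left; lra.
Qed.

Definition tour_loop b :
    {path (unit_interval R) from hawaiian_base R to hawaiian_base R in
     set_type (@hawaiian_earring R)} :=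
  mk_path (@tour_point_continuous b) (tour_point0 b) (tour_point1 b).

Lemma pt_tour_loop b t : 0 <= t <= 1 -> pt (loop_fun (tour_loop b) t) = tour b t.
Proof.
by move=> t01; rewrite /loop_fun /= /mk_path /pt /= uval_clamp_id.
Qed.

Section TourHolonomy.
Context {G : groupType} (g : R -> G) (b : nat -> bool) (n0 : nat).
Hypothesis g_other : forall n, n != n0 -> b n -> g n.+1%:R = 1%g.

(* The time at which the circle number [n0] is at its top: [phase n0 t0 = 0]. *)
Let t0 : R := 3 / 2 ^+ n0.+2.

Lemma phase_lt0 t : (phase n0 t < 0) = (t < t0).
Proof. by rewrite /phase subr_lt0 mulrC ltr_pdivlMr ?exprn_gt0. Qed.

Lemma phase_homo n s t : s <= t -> phase n s <= phase n t.
Proof. by move=> st; rewrite lerB // ler_pM2l ?exprn_gt0. Qed.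

(** The potential of the cocycle along the tour: a single jump, at the top of the
circle number [n0]. *)
Definition tour_lift t : G :=
  if (t < t0) || ~~ b n0 then 1%g else g n0.+1%:R.

Lemma upper_tour s : upper (tour b s) ->
  exists n, [/\ b n, `|phase n s| < 1, curvature (tour b s) = n.+1%:R &
    (tour b s).1 < 0 = (phase n s < 0)].
Proof.
have [[n [bn ns ->]]|->] := tourP b s; last by rewrite /upper /= normr0 ltxx.
have k0 : 0 < n.+1%:R :> R by rewrite ltr0n.
have ns2 : phase n s ^+ 2 < 1.
  by rewrite -(real_normK (num_real _)) expr_lt1.
by move=> _; exists n; rewrite arc_curvature // arc_left.
Qed.

Local Open Scope group_scope.

(** The bound on [t - s] keeps both phases within [1/4] of the top when [t0]
lies between [s] and [t], so that both points are on the upper half.  If the two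
points are on the same upper half then the circle is selected, and it is either
the circle number [n0] or one with trivial label. *)
Lemma tour_crossing s t : (0 <= s)%R -> (s <= t)%R -> (t <= 1)%R ->
    (t - s < 4^-1 / 2 ^+ n0.+2)%R ->
  crossing g (loop_fun (tour_loop b) s) (loop_fun (tour_loop b) t) =
  (tour_lift s)^-1 * tour_lift t.
Proof.
move=> s0 st t1 near_st.
rewrite /crossing !pt_tour_loop ?s0 ?(le_trans st) ?(le_trans s0) //.
case: ifP => [/and3P[us ut /eqP]|not_both].
  have [n [bn ns kn ln]] := upper_tour us.
  have [m [bm mt km lm]] := upper_tour ut.
  rewrite /side kn km => /eqP; rewrite eqr_nat eqSS => /eqP nm.
  subst m; rewrite ln lm.
  have [nn0|nn0] := eqVneq n n0.
    by subst n; rewrite /tour_lift bn !orbF -!phase_lt0.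
  rewrite g_other // !if_same /tour_lift.
  case: (ltP s t0) => [lt_s|le_s]; last by rewrite ltNge (le_trans le_s st) /= mulVg mulVg.
  case: (ltP t t0) => [//|le_t].
  (* Phase [n] contains [s] and [t], hence also [t0], which belongs to phase [n0]. *)
  case/eqP: nn0; apply: (@phase_disjoint n n0 t0).
    move: ns mt; rewrite !ltr_norml => /andP[n1 _] /andP[_ n2].
    by rewrite (lt_le_trans n1) ?phase_homo 1?ltW // (le_lt_trans _ n2) // phase_homo.
  by rewrite /phase /t0 mulrC divfK ?gt_eqF ?exprn_gt0 // subrr normr0.
rewrite /tour_lift; case bn0: (b n0); last by rewrite !orbT mulVg.
rewrite !orbF; case: (ltP s t0) => [lt_s|le_s]; last first.
  by rewrite ltNge (le_trans le_s st) /= mulVg.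
case: (ltP t t0) => [_|le_t]; first by rewrite mulVg.
have ps : (phase n0 s < 0)%R by rewrite phase_lt0.
have pt : (0 <= phase n0 t)%R by rewrite leNgt phase_lt0 -leNgt.
have pst : (phase n0 t - phase n0 s < 4^-1)%R.
  by move: near_st; rewrite ltr_pdivlMr ?exprn_gt0 // /phase; lra.
have near_top r : (`|phase n0 r| <= 4^-1)%R ->
    upper (tour b r) /\ curvature (tour b r) = n0.+1%:R.
  move=> r4; have r1 : (`|phase n0 r| < 1)%R by apply: le_lt_trans r4 _; lra.
  rewrite (tour_active bn0 r1) lap_active //; split; first by apply: arc_upper; rewrite // ler1n.
  by apply: arc_curvature; rewrite ?ltr0n // -(real_normK (num_real _)) expr_lt1.
have [us ks] : upper (tour b s) /\ curvature (tour b s) = n0.+1%:R.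
  by apply: near_top; rewrite ler_norml; apply/andP; split; lra.
have [ut kt] : upper (tour b t) /\ curvature (tour b t) = n0.+1%:R.
  by apply: near_top; rewrite ler_norml; apply/andP; split; lra.
by move: not_both; rewrite us ut ks kt eqxx.
Qed.

(** With labels that are trivial on the other selected circles, the tour crosses
the top of one relevant circle, once. *)
Lemma tour_holonomy :
  holonomy_is (crossing g) (loop_fun (tour_loop b)) (if b n0 then g n0.+1%:R else 1).
Proof.
have e0 : (0 < 4^-1 / 2 ^+ n0.+2 :> R)%R by rewrite divr_gt0 ?exprn_gt0 ?invr_gt0 ?ltr0n.
have := @holonomy_lift _ _ _ (crossing g) (loop_fun (tour_loop b)) tour_lift _ e0 tour_crossing.
have t0_gt0 : (0 < t0)%R by rewrite divr_gt0 ?exprn_gt0.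
have t0_le1 : (t0 <= 1)%R.
  rewrite ler_pdivrMr ?exprn_gt0 // mul1r.
  have : (2 ^+ 2 <= 2 ^+ n0.+2 :> R)%R by rewrite ler_weXn2l // ler1n.
  lra.
rewrite {1}/tour_lift t0_gt0 /= invg1 mul1g /tour_lift (ltNge 1%R) t0_le1 /=.
by case: (b n0).
Qed.

End TourHolonomy.

End Tour.

Local Open Scope group_scope.

(** * The integers as a free group *)

Definition Zgroup : Type := int.
HB.instance Definition _ := Choice.on Zgroup.
HB.instance Definition _ := Countable.on Zgroup.
HB.instance Definition _ := isGroup.Build Zgroup
  (@addrA int) (@add0r int) (@addr0 int) (@addNr int) (@addrN int).

Section ZPower.
Context {G : groupType} (x : G).

Definition zpower (n : Zgroup) : G :=
  match n with Posz m => x ^+ m | Negz m => x ^- m.+1 end.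

Lemma zpowerS (n : int) : zpower (n + 1)%R = zpower n * x.
Proof.
case: n => [n|[|n]] /=; first by rewrite /= addn1 expgSr.
  by rewrite expg1 mulVg.
by rewrite subn1 /= [in RHS]expgS invgM mulgKV.
Qed.

Lemma zpowerB1 (n : int) : zpower (n - 1)%R = zpower n * x^-1.
Proof. by rewrite -{2}(subrK 1%R n) zpowerS mulgK. Qed.

Lemma zpowerD (m n : int) : zpower (m + n)%R = zpower m * zpower n.
Proof.
elim/int_rect: n => [|n IH|n IH]; first by rewrite addr0 /= mulg1.
  by rewrite -addn1 PoszD addrA !zpowerS IH mulgA.
by rewrite -addn1 PoszD opprD addrA !zpowerB1 IH mulgA.
Qed.

Lemma zpowerM : {morph zpower : m n / m * n}.
Proof. exact: zpowerD. Qed.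

End ZPower.

HB.instance Definition _ (G : groupType) (x : G) :=
  isMultiplicative.Build Zgroup G (zpower x) (@zpowerM G x).

Definition Z1 : Zgroup := 1%R.

Lemma zpower1 (G : groupType) (x : G) : zpower x Z1 = x.
Proof. by rewrite /zpower /= expg1. Qed.

Lemma multiplicativeX (G H : groupType) (f : {multiplicative G -> H}) x n :
  f (x ^+ n) = f x ^+ n.
Proof.
by elim: n => [|n IH]; rewrite ?multiplicative1 // !expgS gmulfM IH.
Qed.

Lemma zpowerZ1 (n : Zgroup) : zpower Z1 n = n.
Proof.
have Z1X m : Z1 ^+ m = Posz m by elim: m => // m IH; rewrite expgS IH.
by case: n => [m|m]; rewrite /= Z1X // NegzE.
Qed.

Lemma Zgroup_free : free_group Zgroup.
Proof.
exists [set Z1] => H f; split.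
  exists (zpower (f Z1)) => n; rewrite inE /= => ->; exact: zpower1.
move=> phi psi eq1 n; rewrite -(zpowerZ1 n).
have {}eq1 : phi Z1 = psi Z1 by apply: eq1; rewrite inE.
by case: n => m; rewrite /= ?multiplicativeV !multiplicativeX eq1.
Qed.

Lemma S3_noncommutative : exists s t : {perm 'I_3}, s * t != t * s.
Proof.
pose i0 : 'I_3 := @Ordinal 3 0 isT; pose i1 : 'I_3 := @Ordinal 3 1 isT.
pose i2 : 'I_3 := @Ordinal 3 2 isT.
exists (tperm i0 i1), (tperm i1 i2); apply/eqP => /permP/(_ i0).
rewrite !permM; have -> : tperm i1 i2 i0 = i0 by rewrite tpermD.
by rewrite !tpermL.
Qed.

(** In an abelian group with a basis, two basis elements could be mapped to
noncommuting permutations; so the basis lies in some [[set x]].  Then the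
homomorphism to the integers that sends [x] to [1] is injective, because [x] to
the power of its value is the identity on the basis. *)
Lemma abelian_uncountable_not_free (Q : groupType) :
  (forall x y : Q, x * y = y * x) -> ~ countable [set: Q] -> ~ free_group Q.
Proof.
move=> Qab Qunc [X Xfree].
have X1 : exists x, X `<=` [set x].
  have [X0|/set0P[x Xx]] := eqVneq X set0; first by exists 1; rewrite X0.
  exists x => y Xy; apply: contrapT => /eqP yx.
  have [s [t st]] := S3_noncommutative.
  have [[phi phiE] _] := Xfree {perm 'I_3} (fun z : Q => if z == x then s else t).
  move/eqP: st; apply.
  have := phiE _ (mem_set Xx); have := phiE _ (mem_set Xy).
  rewrite /= eqxx (negbTE yx) => <- <-.
  by rewrite -!gmulfM Qab.
have [x Xx] := X1; apply: Qunc.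
have [[phi phiE] _] := Xfree Zgroup (fun=> Z1).
have [_ Xuniq] := Xfree Q (fun z => z).
pose psi := zpower x \o phi : {multiplicative Q -> Q}.
have phiK : cancel phi (zpower x).
  apply: (Xuniq psi idfun) => y; rewrite inE => Xy.
  by rewrite /psi /= phiE ?inE // zpower1 (Xx _ Xy).
apply/countable_injP; exists (pickle \o phi) => y z _ _.
by move=> /(pcan_inj pickleK) /(can_inj phiK).
Qed.

(** * The image of a homomorphism as a group *)

Section ImageGroup.
Context {G H : groupType} (f : {multiplicative G -> H}).

Definition image_group : Type := set_type (range f).

HB.instance Definition _ := Choice.on image_group.

Lemma image_one_subproof : 1 \in range f.
Proof. by rewrite inE; exists 1 => //; exact: multiplicative1. Qed.

Lemma image_mul_subproof (x y : image_group) : \val x * \val y \in range f.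
Proof.
have := valP x; have := valP y; rewrite !inE => -[b _ <-] [a _ <-].
by exists (a * b) => //; exact: gmulfM.
Qed.

Lemma image_inv_subproof (x : image_group) : (\val x)^-1 \in range f.
Proof.
have := valP x; rewrite !inE => -[a _ <-].
by exists a^-1 => //; exact: multiplicativeV.
Qed.

Definition image_mk (h : H) (hf : h \in range f) : image_group :=
  exist (fun x => x \in range f) h hf.

Definition image_one := image_mk image_one_subproof.
Definition image_mul x y := image_mk (image_mul_subproof x y).
Definition image_inv x := image_mk (image_inv_subproof x).

Lemma image_mulA : associative image_mul.
Proof. by move=> x y z; apply: val_inj; rewrite /= mulgA. Qed.
Lemma image_mul1 : left_id image_one image_mul.
Proof. by move=> x; apply: val_inj; rewrite /= mul1g. Qed.
Lemma image_mulr1 : right_id image_one image_mul.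
Proof. by move=> x; apply: val_inj; rewrite /= mulg1. Qed.
Lemma image_mulV : left_inverse image_one image_inv image_mul.
Proof. by move=> x; apply: val_inj; rewrite /= mulVg. Qed.
Lemma image_mulrV : right_inverse image_one image_inv image_mul.
Proof. by move=> x; apply: val_inj; rewrite /= mulgV. Qed.

HB.instance Definition _ :=
  isGroup.Build image_group image_mulA image_mul1 image_mulr1 image_mulV image_mulrV.

Definition image_incl (x : image_group) : H := \val x.

Lemma image_inclM : {morph image_incl : x y / x * y}.
Proof. by []. Qed.

HB.instance Definition _ := isMultiplicative.Build _ _ image_incl image_inclM.

Lemma image_incl_inj : injective image_incl.
Proof. exact: val_inj. Qed.

Definition image_proj (a : G) : image_group := image_mk (mem_set (imageT f a)).

Lemma image_projM : {morph image_proj : a b / a * b}.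
Proof. by move=> a b; apply: val_inj; rewrite /= gmulfM. Qed.

HB.instance Definition _ := isMultiplicative.Build _ _ image_proj image_projM.

Lemma range_image_proj : range image_proj = [set: image_group].
Proof.
apply/seteqP; split=> // x _; have := valP x; rewrite inE => -[a _ fa].
by exists a => //; apply: val_inj.
Qed.

End ImageGroup.

(** * A product of integers as an inverse limit *)

Definition antichain : Type := nat.
HB.instance Definition _ := Choice.on antichain.

Section Antichain.
Implicit Types i j k : antichain.
Definition antichain_le i j : bool := i == j.
Lemma antichain_le_refl : reflexive antichain_le.
Proof. by move=> i; exact: eqxx. Qed.
Lemma antichain_le_anti : antisymmetric antichain_le.
Proof. by move=> i j /andP[/eqP]. Qed.
Lemma antichain_le_trans : transitive antichain_le.
Proof. by move=> i j k /eqP -> /eqP ->; exact: eqxx. Qed.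
End Antichain.

HB.instance Definition _ := Order.Le_isPOrder.Build (Order.Disp tt tt) antichain
  antichain_le_refl antichain_le_anti antichain_le_trans.

(** On an antichain the only comparisons are reflexive, so the inverse limit is
the full product. *)
Definition Zsystem : inverse_system antichain :=
  @InverseSystem _ antichain (fun=> Zgroup)
    (fun _ _ _ => idfun : {multiplicative Zgroup -> Zgroup})
    (fun _ _ _ _ _ _ _ => erefl).

Section LimitHom.
Context {G : groupType} (phi : nat -> {multiplicative G -> Zgroup}).

Lemma limit_hom_compat (a : G) (i j : antichain) (ji : (j <= i)%O) :
  phi j a = is_map Zsystem ji (phi i a).
Proof.
by have /eqP ji_eq : j == i := ji; rewrite [LHS](congr1 (fun k => phi k a) ji_eq).
Qed.

Definition limit_hom (a : G) : inverse_limit Zsystem :=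
  @InverseLimit _ _ Zsystem (fun i => phi i a) (limit_hom_compat a).

Lemma limit_homM : {morph limit_hom : a b / a * b}.
Proof. by move=> a b; apply: inverse_limit_eq => i; exact: gmulfM. Qed.

HB.instance Definition _ := isMultiplicative.Build _ _ limit_hom limit_homM.

End LimitHom.

(** * The group of winding sequences *)

(** The diagonal argument. *)
Lemma uncountable_of_sequences (Q : Type) (w : (nat -> bool) -> Q) :
  injective w -> ~ countable [set: Q].
Proof.
move=> w_inj /countable_injP[h h_inj].
have hw_inj b b' : h (w b) = h (w b') -> b = b'.
  by move=> hh; apply/w_inj/h_inj; rewrite ?inE.
pose d n := `[< exists b, h (w b) = n /\ b n = false >].
have dd : d (h (w d)) = ~~ d (h (w d)).
  apply/idP/idP => [/asboolP[b [/hw_inj -> ->]]//|/negPf df].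
  by apply/asboolP; exists d.
by case: (d _) dd.
Qed.

Section Main.
Variable R : realType.
Local Notation HG := (hawaiian_earring_group R).

(** A finite list of labels for the circles, turned into a function of the
curvature. *)
Definition label (G : groupType) (u : nat -> G) (N : nat) (r : R) : G :=
  if pselect (exists n : nat, (n < N)%N && (r == n.+1%:R)%R) is left h then u (xchoose h) else 1.

Lemma labelE (G : groupType) (u : nat -> G) N n :
  label u N n.+1%:R%R = if (n < N)%N then u n else 1.
Proof.
rewrite /label; case: pselect => [h|no].
  have := xchooseP h; move: (xchoose h) => m /andP[lt].
  by rewrite eqr_nat eqSS => /eqP ->; rewrite lt.
by case: ifP => // lt; case: no; exists n; rewrite lt eqxx.
Qed.

Lemma label_large (G : groupType) (u : nat -> G) N r : (N%:R < r)%R -> label u N r = 1.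
Proof.
move=> Nr; rewrite /label; case: pselect => // h; have [n /andP[lt /eqP rn]] := h.
suff : (N%:R < n.+1%:R :> R)%R by rewrite ltr_nat ltnNge lt.
by rewrite -rn.
Qed.

(** Only the first [N] circles are labelled, since [crossing] is a local cocycle
at the base point only if almost all labels are trivial. *)
Lemma circle_hom (G : groupType) (u : nat -> G) (N : nat) :
  exists phi : {multiplicative HG -> G}, forall (b : nat -> bool) (n0 : nat),
    (forall n, n != n0 -> b n -> (n < N)%N -> u n = 1) ->
    phi (pi1_class (tour_loop b)) = if b n0 && (n0 < N)%N then u n0 else 1.
Proof.
have loc : local_cocycle (crossing (label u N)) := crossing_local (@label_large G u N).
have [phi phiE] := @holonomy_hom R _ _ _ loc (hawaiian_base R).
exists phi => b n0 other; rewrite (phiE _ _ (@tour_holonomy _ _ _ b n0 _)).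
  by rewrite labelE; case: (b n0).
move=> n nn0 bn; rewrite labelE; case: ifP => // lt; exact: other nn0 bn lt.
Qed.

(** The loops around the two largest circles, labelled with two noncommuting
permutations. *)
Lemma hawaiian_group_noncommutative : exists x y : HG, x * y <> y * x.
Proof.
have [s [t st]] := S3_noncommutative.
have [phi phiE] := @circle_hom _ (fun n => if n is 0 then s else t) 2.
pose b n : nat -> bool := fun m => m == n.
exists (pi1_class (tour_loop (b 0%N))), (pi1_class (tour_loop (b 1%N))).
move=> /(congr1 phi); rewrite !gmulfM.
have phib n : (n < 2)%N -> phi (pi1_class (tour_loop (b n))) = if n is 0 then s else t.
  by move=> lt; rewrite (phiE _ n) ?/b ?eqxx ?lt // => m /negPf ->.
by rewrite !phib //; apply/eqP.
Qed.

(** The label [1] on a single circle counts how many times a loop winds around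
that circle. *)
Lemma winding_homs :
  exists phi : nat -> {multiplicative HG -> Zgroup}, forall (b : nat -> bool) n,
    phi n (pi1_class (tour_loop b)) = if b n then Z1 else 1.
Proof.
have /choice[phi phiE] : forall n, exists phi : {multiplicative HG -> Zgroup},
    forall b, phi (pi1_class (tour_loop b)) = if b n then Z1 else 1.
  move=> n; have [phi phiE] := @circle_hom _ (fun m => if m == n then Z1 else 1) n.+1.
  exists phi => b; rewrite (phiE b n); last by move=> m /negPf ->.
  by rewrite ltnS leqnn andbT eqxx.
by exists phi.
Qed.

End Main.

Theorem mainTheorem2 (R : realType) :
  exists Q : groupType,
    [/\ ~ countable [set: Q],
        homomorphic_image Q (hawaiian_earring_group R),
        embeds_in_inverse_limit_of_free_groups Q,
        ~ isomorphic Q (hawaiian_earring_group R)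
      & ~ free_group Q].
Proof.
have [phi phiE] := winding_homs R.
pose f : {multiplicative _ -> _} := limit_hom phi.
pose Q : groupType := image_group f.
have Qab (x y : Q) : x * y = y * x.
  apply: image_incl_inj; apply: inverse_limit_eq => i; exact: addrC.
have Qunc : ~ countable [set: Q].
  apply: (@uncountable_of_sequences Q (fun b => image_proj f (pi1_class (tour_loop b)))).
  move=> b b' /(congr1 (fun x : Q => il_fun (image_incl x))) bb'.
  apply: funext => n; have := congr1 (fun l => l n) bb'.
  by rewrite /= !phiE; case: (b n) (b' n) => [] [].
exists Q; split=> //.
- exists (image_proj f : {multiplicative _ -> Q}); exact: range_image_proj.
- exists _, antichain, Zsystem; split=> [i|]; first exact: Zgroup_free.
  exists (@image_incl _ _ f : {multiplicative Q -> _}); exact: image_incl_inj.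
- move=> [h [h' _ hK]]; have [x [y]] := hawaiian_group_noncommutative R; apply.
  by rewrite -(hK x) -(hK y) -!gmulfM Qab.
- exact: abelian_uncountable_not_free.
Qed.
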